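(* Suppose $2<p<q<p_s^*$, $\lambda>0$, and let $\mu$ be a Radon measure on $\Omega$. If the problem $$-\mathscr{L}_\Phi u=\lambda|u|^{q-2}u+\mu\ \text{ in }\Omega,\qquad u=0\ \text{ in }\mathbb{R}^N\setminus\Omega$$ has a weak solution $u$, then $\mu\in L^1(\Omega)+W^{-s,p'}(\Omega)$.
   Context: Let $N\ge 2$, let $\Omega\subset\mathbb{R}^N$ be a bounded open set, $s\in(0,1)$, $p'=\frac{p}{p-1}$, and $p_s^*=\frac{Np}{N-sp}$ if $sp<N$, $p_s^*=\infty$ if $sp\ge N$. Let $\Lambda\ge 1$. Let $\Phi:\mathbb{R}\to\mathbb{R}$ be continuous with $\Phi(0)=0$ and $\Lambda^{-1}|t|^p\le \Phi(t)t\le\Lambda|t|^p$ for all $t\in\mathbb{R}$. Let $K:\mathbb{R}^N\times\mathbb{R}^N\to\mathbb{R}$ be measurable with $\frac{1}{\Lambda|x-y|^{N+sp}}\le K(x,y)\le\frac{\Lambda}{|x-y|^{N+sp}}$ for all $x\ne y$ in $\mathbb{R}^N$. The nonlocal operator $-\mathscr{L}_\Phi$ is defined by $$\langle-\mathscr{L}_\Phi u,\varphi\rangle=\int_{\mathbb{R}^N}\int_{\mathbb{R}^N}\Phi(u(x)-u(y))(\varphi(x)-\varphi(y))K(x,y)\,dx\,dy .$$ $W^{s,p}(\mathbb{R}^N)$ is the space of $u\in L^p(\mathbb{R}^N)$ with $[u]_{s,p}=\left(\int_{\mathbb{R}^{2N}}\frac{|u(x)-u(y)|^p}{|x-y|^{N+sp}}dx\,dy\right)^{1/p}<\infty$;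 $W_0^{s,p}(\Omega)=\{u\in W^{s,p}(\mathbb{R}^N): u=0 \text{ a.e. in }\mathbb{R}^N\setminus\Omega\}$, normed by $[u]_{s,p}$; and $W^{-s,p'}(\Omega)$ is the dual space of $W_0^{s,p}(\Omega)$. A weak solution of the problem is a function $u\in W_0^{s,p}(\Omega)$ such that for every $\varphi\in C_c^\infty(\Omega)$ $$\int_{\mathbb{R}^N}\int_{\mathbb{R}^N}\Phi(u(x)-u(y))(\varphi(x)-\varphi(y))K(x,y)\,dx\,dy=\lambda\int_\Omega|u|^{q-2}u\,\varphi\,dx+\int_\Omega\varphi\,d\mu .$$ The conclusion $\mu\in L^1(\Omega)+W^{-s,p'}(\Omega)$ means that there are $h\in L^1(\Omega)$ and $T\in W^{-s,p'}(\Omega)$ with $\int_\Omega\varphi\,d\mu=\int_\Omega h\varphi\,dx+\langle T,\varphi\rangle$ for all $\varphi\in C_c^\infty(\Omega)$. *)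

(* Defs.v *)
From HB Require Import structures.
From mathcomp Require Import all_boot all_order all_algebra.
From mathcomp Require Import all_classical all_reals all_analysis.
From mathcomp Require Import ring lra.

Set Implicit Arguments.
Unset Strict Implicit.
Unset Printing Implicit Defensive.
Import Order.TTheory GRing.Theory Num.Theory.
Import numFieldNormedType.Exports.

Local Open Scope classical_set_scope.
Local Open Scope ring_scope.

Section borel_rV.
Context {R : realType} (n : nat).

Let borel_set0 : <<s @open 'rV[R]_n >> set0.
Proof. exact: sigma_algebra0. Qed.

Let borel_setC A : <<s @open 'rV[R]_n >> A -> <<s @open 'rV[R]_n >> (~` A).
Proof. exact: sigma_algebraC. Qed.

Let borel_bigcup (F : (set 'rV[R]_n)^nat) :
  (forall i, <<s @open 'rV[R]_n >> (F i)) ->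
  <<s @open 'rV[R]_n >> (\bigcup_i F i).
Proof. exact: sigma_algebra_bigcup. Qed.

HB.instance Definition _ := @isMeasurable.Build default_measure_display
  'rV[R]_n <<s @open 'rV[R]_n >> borel_set0 borel_setC borel_bigcup.

End borel_rV.

Section measurable_rV.
Context {R : realType}.

Lemma open_measurable_rV n (A : set 'rV[R]_n) : open A -> measurable A.
Proof. exact: sub_sigma_algebra. Qed.

Lemma measurable_coord_rV n (i : 'I_n) :
  measurable_fun [set: 'rV[R]_n] (fun x => x ord0 i).
Proof.
apply: (measurability _ (measurable_realfun.RGenOpens.measurableE R)) => //.
move=> _ [_ [a [b ->] <-]]; rewrite setTI; apply: open_measurable_rV.
apply: open_comp => [x _|]; first exact: coord_continuous.
exact: interval_open.
Qed.

Lemma measurable_fun_rVP d (T : measurableType d) n (f : T -> 'rV[R]_n) :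
  measurable_fun setT f <->
  forall i, measurable_fun setT (fun t => f t ord0 i).
Proof.
split=> [mf i|mf].
  exact: (measurableT_comp (measurable_coord_rV i) mf).
apply: (@measurability _ _ T (matrix R 1 n : measurableType _) setT f open) => //.
move=> _ [A oA <-]; rewrite setTI.
pose box (c : 'rV[rat]_n * rat) : set 'rV[R]_n :=
  [set x | forall i, ratr (c.1 ord0 i) - ratr c.2 < x ord0 i <
                     ratr (c.1 ord0 i) + ratr c.2].
have -> : A = \bigcup_(c in [set c | box c `<=` A]) box c.
  apply/seteqP; split=> [x Ax|x [c cA cx]]; last exact: cA.
  have /nbhs_ballP[e /= e0 eA] : nbhs x A by exact: open_nbhs_nbhs.
  have [r rP] : exists r : rat, 0 < (ratr r : R) < e / 2.
    have : (0 : R) < e / 2 by rewrite divr_gt0.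
    by move=> /rat_in_itvoo[r]; rewrite in_itv/= => ?; exists r.
  have /choice[q qP] : forall i, exists q : rat,
      x ord0 i - ratr r < ratr q < x ord0 i + ratr r.
    move=> i; have : x ord0 i - ratr r < x ord0 i + ratr r.
      by case/andP: rP => ? ?; lra.
    by move=> /rat_in_itvoo[s]; rewrite in_itv/= => ?; exists s.
  exists (\row_i q i, r) => /=; last first.
    move=> i; rewrite mxE; have /andP[? ?] := qP i.
    by apply/andP; split; lra.
  move=> y /= yP; apply: eA; split=> // i j.
  rewrite (ord1 i); have := yP j; have := qP j; rewrite mxE => /andP[a b] /andP[c d'].
  rewrite /ball/= ltr_norml; apply/andP; split; lra.
rewrite preimage_bigcup bigcup_mkcond; apply: countable_bigcupT_measurable.
  exact: countableP.
move=> c; case: ifPn => // _.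
have -> : f @^-1` box c = \bigcap_(i in [set: 'I_n])
    ((fun t => f t ord0 i) @^-1` `](ratr (c.1 ord0 i) - ratr c.2),
                                    (ratr (c.1 ord0 i) + ratr c.2)[%classic).
  apply/seteqP; split=> [t /= bt i _ /=|t /= bt i]; first by rewrite in_itv/=.
  by have := bt i I; rewrite /= in_itv.
apply: fin_bigcap_measurable => // i _.
by rewrite -[X in measurable X]setTI; apply: mf => //; exact: measurable_itv.
Qed.

End measurable_rV.

Section lebesgue_rV.
Context {R : realType}.

Definition rV_cons n (z : R * 'rV[R]_n) : 'rV[R]_n.+1 :=
  \row_i if unlift ord0 i is Some j then z.2 ord0 j else z.1.

Definition rV_behead n (x : 'rV[R]_n.+1) : 'rV[R]_n :=
  \row_j x ord0 (lift ord0 j).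

Lemma measurable_rV_cons n : measurable_fun setT (@rV_cons n).
Proof.
apply/measurable_fun_rVP => i; under eq_fun do rewrite mxE.
case: unliftP => [j _|_]; last exact: measurable_fst.
exact: (measurableT_comp (measurable_coord_rV j) measurable_snd).
Qed.

Lemma measurable_rV_behead n : measurable_fun setT (@rV_behead n).
Proof.
apply/measurable_fun_rVP => i; under eq_fun do rewrite mxE.
exact: measurable_coord_rV.
Qed.

Lemma rV_consK n : cancel (@rV_cons n) (fun x => (x ord0 ord0, rV_behead x)).
Proof.
case=> a x; rewrite mxE unlift_none; congr pair.
by apply/rowP => j; rewrite !mxE liftK.
Qed.

Lemma rV_beheadK n :
  cancel (fun x : 'rV[R]_n.+1 => (x ord0 ord0, rV_behead x)) (@rV_cons n).
Proof.
move=> x; apply/rowP => i; rewrite mxE; case: unliftP => [j ->|->] //=.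
by rewrite mxE.
Qed.

Section step.
Variables (n : nat) (m : {sigma_finite_measure set 'rV[R]_n -> \bar R}).
Let mf := @measurable_rV_cons n.

Definition lebesgue_step : set 'rV[R]_n.+1 -> \bar R :=
  pushforward (@lebesgue_measure R \x m)%E (@rV_cons n).

Let step0 : lebesgue_step set0 = 0%E.
Proof. by rewrite /lebesgue_step /pushforward preimage_set0 measure0. Qed.

Let step_ge0 A : (0 <= lebesgue_step A)%E.
Proof. exact: measure_ge0. Qed.

Let step_sigma_additive : semi_sigma_additive lebesgue_step.
Proof. exact: measure_semi_sigma_additive. Qed.

HB.instance Definition _ := isMeasure.Build _ _ _ lebesgue_step
  step0 step_ge0 step_sigma_additive.

Let step_sigma_finite : sigma_finite setT lebesgue_step.
Proof.
have /sigma_finiteP[F [TF ndF Foo]] := sigma_finiteT (@lebesgue_measure R).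
have /sigma_finiteP[G [TG ndG Goo]] := sigma_finiteT m.
pose uncons (x : 'rV[R]_n.+1) := (x ord0 ord0, rV_behead x).
exists (fun k => uncons @^-1` (F k `*` G k)).
  apply/seteqP; split=> // x _.
  have : [set: measurableTypeR R] (x ord0 ord0) by [].
  have : [set: 'rV[R]_n] (rV_behead x) by [].
  rewrite TF TG => -[k _ Gk] [l _ Fl]; exists (maxn k l) => //; split.
    by have /subsetPset := ndF _ _ (leq_maxr k l); apply.
  by have /subsetPset := ndG _ _ (leq_maxl k l); apply.
move=> k; have [mF Fk] := Foo k; have [mG Gk] := Goo k; split.
  rewrite -[X in measurable X]setTI.
  apply: (measurable_fun_pair (measurable_coord_rV ord0)) => //.
    exact: measurable_rV_behead.
  exact: measurableX.
rewrite /lebesgue_step /pushforward -comp_preimage.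
rewrite (_ : uncons \o _ = id) ?preimage_id; last first.
  by apply/funext => z /=; rewrite -[RHS]rV_consK.
by rewrite product_measure1E// lte_mul_pinfty// ge0_fin_numE.
Qed.

HB.instance Definition _ := Measure_isSigmaFinite.Build _ _ _ lebesgue_step
  step_sigma_finite.

End step.

Fixpoint lebesgue_rV n : {sigma_finite_measure set 'rV[R]_n -> \bar R} :=
  if n is k.+1 then lebesgue_step (lebesgue_rV k) else \d_(0 : 'rV[R]_0).

Lemma lebesgue_rV_box n (a b : 'rV[R]_n) :
  (forall i, a ord0 i <= b ord0 i) ->
  lebesgue_rV n [set x | forall i, a ord0 i <= x ord0 i <= b ord0 i] =
  (\prod_i (b ord0 i - a ord0 i))%:E.
Proof.
elim: n a b => [|n IH] a b ab.
  rewrite big_ord0 /= diracE mem_set//= => -[].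
  done.
set B := [set x : 'rV[R]_n |
  forall i, rV_behead a ord0 i <= x ord0 i <= rV_behead b ord0 i].
have mB : measurable B.
  rewrite (_ : B = \bigcap_(i in [set: 'I_n]) ((fun x => x ord0 i) @^-1`
      `[rV_behead a ord0 i, rV_behead b ord0 i]%classic)).
    apply: fin_bigcap_measurable => // i _.
    rewrite -[X in measurable X]setTI; apply: measurable_coord_rV => //.
  apply/seteqP; split=> [t /= bt i _ /=|t /= bt i]; first by rewrite in_itv/=.
  by have := bt i I; rewrite /= in_itv.
transitivity ((@lebesgue_measure R \x lebesgue_rV n)%E
    (`[a ord0 ord0, b ord0 ord0]%classic `*` B)).
  congr (product_measure1 _ _ _).
  apply/seteqP; split=> [[t x] /= h|[t x] /= [h1 h2] i].
    split; first by have := h ord0; rewrite !mxE unlift_none in_itv.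
    by move=> i; have := h (lift ord0 i); rewrite !mxE liftK.
  rewrite mxE; case: unliftP => [j ->|->] //=.
  by have := h2 j; rewrite !mxE.
rewrite product_measure1E//= IH => [|i]; last by rewrite !mxE.
rewrite lebesgue_measure_itv/= lte_fin big_ord_recl.
under eq_bigr do rewrite !mxE.
case: ltP => [_|ba]; first by rewrite -EFinB -EFinM.
have -> : b ord0 ord0 = a ord0 ord0 by apply/le_anti; rewrite ab ba.
by rewrite mul0e subrr mul0r.
Qed.

End lebesgue_rV.

(* R^N is 'rV[R]_N; the Lebesgue measure is the N-fold product measure and
   lebesgue_rV_box is its value on boxes, which characterizes it. *)
Section function_spaces.
Context {R : realType} {N : nat}.
Implicit Types (Omega : set 'rV[R]_N) (u : 'rV[R]_N -> R) (s p : R).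

(* The library's norm on 'rV[R]_N is the sup norm. *)
Definition enorm (x : 'rV[R]_N) : R := Num.sqrt (\sum_i x ord0 i ^+ 2).

Definition lebesgue2 : {measure set ('rV[R]_N * 'rV[R]_N)%type -> \bar R} :=
  (lebesgue_rV N \x lebesgue_rV N)%E.

(* The measurable sets of the library are the Borel ones; a function is
   Lebesgue measurable iff it agrees almost everywhere with a Borel function. *)
Definition lebesgue_measurable2 (f : 'rV[R]_N * 'rV[R]_N -> R) : Prop :=
  exists2 g : 'rV[R]_N * 'rV[R]_N -> R,
    measurable_fun setT g & {ae lebesgue2, forall z, f z = g z}.

Definition gagliardo s p u : \bar R :=
  ((\int[lebesgue2]_z
     (`|u z.1 - u z.2| `^ p / enorm (z.1 - z.2) `^ (N%:R + s * p))%:E)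
   `^ p^-1)%E.

(* Elements of L^p are represented by their Borel representatives. *)
Definition Wsp s p : set ('rV[R]_N -> R) :=
  [set u | u \in Lfun (lebesgue_rV N) p%:E /\ (gagliardo s p u < +oo)%E].

Definition W0sp s p Omega : set ('rV[R]_N -> R) :=
  [set u | Wsp s p u /\
    {ae lebesgue_rV N, forall x, (~` Omega) x -> u x = 0}].

(* Continuous linear functionals on W0sp, which is normed by gagliardo; the
   values of T outside W0sp are irrelevant. Boundedness forces T to respect
   almost everywhere equality. *)
Definition dual_W0sp s p Omega : set (('rV[R]_N -> R) -> R) :=
  [set T | (forall (a : R) u v, W0sp s p Omega u -> W0sp s p Omega v ->
              T (fun x => a * u x + v x) = a * T u + T v) /\
           exists C : R, forall u, W0sp s p Omega u ->
              (`|T u|%:E <= C%:E * gagliardo s p u)%E].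

Definition sobolev_exponent s p : \bar R :=
  if s * p < N%:R then (N%:R * p / (N%:R - s * p))%:E else +oo%E.

Fixpoint Ck (k : nat) (f : 'rV[R]_N -> R) : Prop :=
  if k is k'.+1 then (forall x, differentiable f x) /\ forall v, Ck k' ('D_v f)
  else continuous f.

Definition Cc_infty Omega : set ('rV[R]_N -> R) :=
  [set f | [/\ forall k, Ck k f, compact (closure [set x | f x != 0])
              & closure [set x | f x != 0] `<=` Omega]].

(* mu is a measure on the whole space, but only its restriction to Omega is
   constrained and used. *)
Definition radon Omega (mu : {measure set 'rV[R]_N -> \bar R}) : Prop :=
  (forall A, compact A -> A `<=` Omega -> (mu A < +oo)%E) /\
  (forall A, measurable A -> A `<=` Omega ->
     mu A = ereal_sup [set mu B | B in [set B | compact B /\ B `<=` A]]).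

(* A signed Radon measure, i.e. a difference of two nonnegative ones. Both may
   have infinite mass near the boundary of Omega, in which case the difference
   makes sense only on compact subsets or integrated against functions with
   compact support. *)
Record signed_radon Omega := SignedRadon {
  radon_pos : {measure set 'rV[R]_N -> \bar R};
  radon_neg : {measure set 'rV[R]_N -> \bar R};
  radon_posP : radon Omega radon_pos;
  radon_negP : radon Omega radon_neg }.

Definition radon_int Omega (mu : signed_radon Omega) (f : 'rV[R]_N -> R) : R :=
  \int[radon_pos mu]_(x in Omega) f x - \int[radon_neg mu]_(x in Omega) f x.

Definition L1_plus_dual s p Omega (mu : signed_radon Omega) : Prop :=
  exists (h : 'rV[R]_N -> R) (T : ('rV[R]_N -> R) -> R),
    [/\ (lebesgue_rV N).-integrable Omega (EFin \o h),
        dual_W0sp s p Omega T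
      & forall f, Cc_infty Omega f ->
          radon_int mu f = \int[lebesgue_rV N]_(x in Omega) (h x * f x) + T f].

(* All the integrals of real-valued functions below converge absolutely for u
   in W0sp and f in Cc_infty, by Hoelder's and Sobolev's inequalities, so that
   the convention of Rintegral on divergent integrals plays no role. *)
Definition nonlocal_form (Phi : R -> R) (K : 'rV[R]_N -> 'rV[R]_N -> R)
    u (f : 'rV[R]_N -> R) : R :=
  \int[lebesgue2]_z (Phi (u z.1 - u z.2) * (f z.1 - f z.2) * K z.1 z.2).

Definition weak_solution s p q lambda (Phi : R -> R)
    (K : 'rV[R]_N -> 'rV[R]_N -> R) Omega (mu : signed_radon Omega) u : Prop :=
  W0sp s p Omega u /\
  forall f, Cc_infty Omega f ->
    nonlocal_form Phi K u f =
    lambda * (\int[lebesgue_rV N]_(x in Omega)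
                (`|u x| `^ (q - 2) * u x * f x))
    + radon_int mu f.

End function_spaces.
Arguments sobolev_exponent {R} N s p.

(* Main.v *)
Require Import Defs.
From mathcomp Require Import all_boot all_order all_algebra.
From mathcomp Require Import all_classical all_reals all_analysis.
From mathcomp Require Import measurable_realfun.
From mathcomp Require Import ring lra.

Set Implicit Arguments.
Unset Strict Implicit.
Unset Printing Implicit Defensive.
Import Order.TTheory GRing.Theory Num.Theory.
Import numFieldNormedType.Exports.

Local Open Scope classical_set_scope.
Local Open Scope ring_scope.

(** The weak formulation already exhibits the decomposition: for a test
   function f,
     int f dmu = int (- lambda |u|^(q-2) u) f dx + T f,
   where T f is the nonlocal form of u against f. Two facts remain.

   T is linear and bounded on W_0^{s,p} ([nonlocal_form_dual]). The growth of
   Phi and the upper bound on K dominate the integrand of T f by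
   Lambda^2 U^(p-1) F, where U and F are the difference quotients of u and f
   whose L^p norms are the Gagliardo seminorms; Hoelder's inequality concludes.
   As K is only Lebesgue measurable, linearity is proved after replacing K by a
   Borel function equal to it almost everywhere.

   |u|^(q-1) is integrable on Omega ([Wsp_powR_integrable]). This is a
   subcritical fractional Sobolev embedding, obtained as follows. Suppose that
   |u|^r is integrable, and let a = |u x| > 0. By Markov's inequality, if t^N is
   a suitable multiple of a^(-r), then |u y| < a/2 on at least half of the cube
   of centre x and half-side t. There |u x - u y| >= a/2, so that
     int |u x - u y|^p / |x - y|^(N+sp) dy >= c a^p t^(-sp)
                                            = c' a^(p + (sp/N) r).
   Integrating in x, |u|^(p + (sp/N) r) is integrable ([integrability_gain]).
   The map r |-> p + (sp/N) r has the critical exponent as its fixed point when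
   sp < N and no positive one otherwise, so iterating it from r = p reaches any
   subcritical q after finitely many steps ([subcritical_integrability]). *)

(** * Integrals of functions equal almost everywhere *)

Section integral_ae.
Local Open Scope ereal_scope.
Context d (T : measurableType d) (R : realType).
Variable mu : {measure set T -> \bar R}.
Import HBNNSimple.

(** Neither function is assumed measurable: the integral is a supremum over
   simple functions, and a simple function may be set to zero on a negligible
   measurable set without changing its integral. *)
Lemma ge0_le_integral_ae (f g : T -> \bar R) :
  (forall x, 0 <= f x) -> (forall x, 0 <= g x) ->
  {ae mu, forall x, f x <= g x} -> \int[mu]_x f x <= \int[mu]_x g x.
Proof.
move=> f0 g0 [A [mA A0 fgA]].
rewrite !ge0_integralTE//; apply: ge_ereal_sup => _ [h hf <-].
have mAC := measurableC mA.
pose h' := proj_nnsfun h mAC.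
have <- : sintegral mu h' = sintegral mu h.
  rewrite -!integralT_nnsfun; apply: ge0_ae_eq_integral => //.
  - exact/measurable_EFinP.
  - exact/measurable_EFinP.
  - by move=> x _; rewrite lee_fin.
  - by move=> x _; rewrite lee_fin.
  - exists A; split=> //= x /= hx; apply: contrapT => xA; apply: hx => _.
    by rewrite /= mindicE mem_set//= mulr1.
apply: ereal_sup_ubound; exists h' => //= x.
rewrite /= mindicE; have [xA|] := boolP (x \in ~` A); last by rewrite mulr0.
rewrite mulr1 (le_trans (hf x))//; apply: contrapT => fgx.
by move/set_mem : xA; apply; exact: fgA.
Qed.

Lemma integral_ae_eq (f g : T -> \bar R) :
  {ae mu, forall x, f x = g x} -> \int[mu]_x f x = \int[mu]_x g x.
Proof.
move=> fg; rewrite integralE [RHS]integralE.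
by congr (_ - _); apply/eqP; rewrite eq_le; apply/andP; split;
  apply: ge0_le_integral_ae => //; move: fg; apply: filterS => x fgx;
  rewrite ?funeposE ?funenegE fgx.
Qed.

Lemma Rintegral_ae_eq (f g : T -> R) :
  {ae mu, forall x, f x = g x} -> (\int[mu]_x f x = \int[mu]_x g x)%R.
Proof.
move=> fg; congr fine; apply: integral_ae_eq.
by move: fg; apply: filterS => x ->.
Qed.

End integral_ae.

(** * Difference quotients and the Gagliardo seminorm *)

Lemma measurable_normr_powR d (T : measurableType d) (R : realType)
    (u : T -> R) (r : R) :
  measurable_fun setT u -> measurable_fun setT (fun x => `|u x| `^ r).
Proof.
move=> mu; apply: (measurableT_comp (measurable_powR _)).
exact: measurableT_comp.
Qed.

Section gagliardo_quotient.
Context {R : realType} {N : nat}.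
Implicit Types (u v : 'rV[R]_N -> R) (s p : R).

Lemma enorm_ge0 (x : 'rV[R]_N) : 0 <= enorm x.
Proof. exact: sqrtr_ge0. Qed.

Lemma enorm_eq0 (x : 'rV[R]_N) : (enorm x == 0) = (x == 0).
Proof.
rewrite sqrtr_eq0; apply/idP/idP => [x0|/eqP->]; last first.
  by rewrite big1// => i _; rewrite mxE expr0n.
have {x0} /eqP : \sum_i x ord0 i ^+ 2 == 0.
  by rewrite eq_le x0 sumr_ge0// => i _; exact: sqr_ge0.
move=> /psumr_eq0P x0; apply/eqP/rowP => i; rewrite mxE.
by apply/eqP; rewrite -sqrf_eq0 x0// => j _; exact: sqr_ge0.
Qed.

Lemma measurable_enorm : measurable_fun setT (@enorm R N).
Proof.
apply: (@measurableT_comp _ _ _ _ _ _ (@Num.sqrt R)).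
  by apply: continuous_measurable_fun; exact: sqrt_continuous.
apply: measurable_sum => i; apply: measurable_funX.
exact: measurable_coord_rV.
Qed.

Lemma measurable_subr_rV :
  measurable_fun setT (fun z : 'rV[R]_N * 'rV[R]_N => z.1 - z.2).
Proof.
apply/measurable_fun_rVP => i; under eq_fun do rewrite !mxE.
apply: measurable_funB.
  exact: (measurableT_comp (measurable_coord_rV i) measurable_fst).
exact: (measurableT_comp (measurable_coord_rV i) measurable_snd).
Qed.

Lemma measurable_increment u : measurable_fun setT u ->
  measurable_fun setT (fun z : 'rV[R]_N * 'rV[R]_N => u z.1 - u z.2).
Proof.
move=> mu; apply: measurable_funB.
  exact: (measurableT_comp mu measurable_fst).
exact: (measurableT_comp mu measurable_snd).
Qed.

(** The weighted difference quotient |u x - u y| / |x - y|^((N+sp)/p), whose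
   L^p norm over R^N x R^N is the Gagliardo seminorm. It vanishes on the
   diagonal, where the numerator does. *)
Definition gquot s p u (z : 'rV[R]_N * 'rV[R]_N) : R :=
  `|u z.1 - u z.2| * enorm (z.1 - z.2) `^ (- ((N%:R + s * p) / p)).

Lemma gquot_ge0 s p u z : 0 <= gquot s p u z.
Proof. by rewrite mulr_ge0// powR_ge0. Qed.

Lemma gquot_powR s p u z : p != 0 -> gquot s p u z `^ p =
  `|u z.1 - u z.2| `^ p / enorm (z.1 - z.2) `^ (N%:R + s * p).
Proof.
by move=> p0; rewrite powRM ?powR_ge0// -powRrM mulNr divfK// powRN.
Qed.

Lemma measurable_gquot s p u : measurable_fun setT u ->
  measurable_fun setT (gquot s p u).
Proof.
move=> mu; apply: measurable_funM.
  by apply: measurableT_comp => //; exact: measurable_increment.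
apply: (measurableT_comp (measurable_powR _)).
exact: (measurableT_comp measurable_enorm measurable_subr_rV).
Qed.

Lemma gagliardoE s p u : p != 0 ->
  gagliardo s p u = 'N[lebesgue2]_p%:E[EFin \o gquot s p u]%E.
Proof.
move=> p0; rewrite unlock /gagliardo; congr (_ `^ _)%E.
apply: eq_integral => z _.
by rewrite -gquot_powR//= ger0_norm// gquot_ge0.
Qed.

Lemma gquot_integral_lty s p u : p != 0 -> (gagliardo s p u < +oo)%E ->
  (\int[lebesgue2]_z (gquot s p u z `^ p)%:E < +oo)%E.
Proof.
move=> p0 /lty_poweRy; rewrite invr_eq0 => /(_ p0); apply: le_lt_trans.
rewrite le_eqVlt; apply/orP; left; apply/eqP/eq_integral => z _.
by rewrite gquot_powR.
Qed.

(** Hoelder's inequality with exponents p / (p-1) and p; the constant is the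
   (p-1)-th power of the seminorm of [u]. *)
Lemma hoelder_gquot s p u : 1 < p -> measurable_fun setT u ->
  (gagliardo s p u < +oo)%E ->
  exists2 C : R, 0 <= C & forall v, measurable_fun setT v ->
    (\int[lebesgue2]_z (gquot s p u z `^ (p - 1) * gquot s p v z)%:E <=
     C%:E * gagliardo s p v)%E.
Proof.
move=> p1 mu u_fin.
have p0 : 0 < p by rewrite (lt_trans _ p1).
have pB1 : 0 < p - 1 by rewrite subr_gt0.
have pn0 := lt0r_neq0 p0; have pBn0 := lt0r_neq0 pB1.
set f := fun z => gquot s p u z `^ (p - 1).
have mf : measurable_fun setT f.
  exact: (measurableT_comp (measurable_powR _) (measurable_gquot _ _ mu)).
have q0 : 0 < p / (p - 1) by rewrite divr_gt0.
have pq : (p / (p - 1))^-1 + p^-1 = 1.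
  by rewrite invf_div -[X in _ + X]mul1r -mulrDl subrK mulfV.
have Nf : ('N[lebesgue2]_(p / (p - 1))%:E[EFin \o f] < +oo)%E.
  rewrite unlock; apply: poweR_lty.
  apply: le_lt_trans (gquot_integral_lty pn0 u_fin).
  rewrite le_eqVlt; apply/orP; left; apply/eqP/eq_integral => z _ /=.
  by rewrite /f ger0_norm ?powR_ge0// -powRrM mulrCA divff// mulr1.
have Nf0 := Lnorm_ge0 lebesgue2 (p / (p - 1))%:E (EFin \o f).
exists (fine ('N[lebesgue2]_(p / (p - 1))%:E[EFin \o f])).
  exact: fine_ge0.
move=> v mv; have := hoelder lebesgue2 mf (measurable_gquot s p mv) q0 p0 pq.
rewrite -gagliardoE// Lnorm1 => H.
rewrite fineK ?ge0_fin_numE//; apply: le_trans H.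
rewrite le_eqVlt; apply/orP; left; apply/eqP/eq_integral => z _ /=.
by rewrite ger0_norm// mulr_ge0 ?powR_ge0// gquot_ge0.
Qed.

End gagliardo_quotient.

(** * The nonlocal form as a bounded functional *)

Section nonlocal_form_dual.
Context {R : realType} {N : nat}.
Variables (s p Lambda : R) (Phi : R -> R) (K : 'rV[R]_N -> 'rV[R]_N -> R).
Hypotheses (p_gt1 : 1 < p) (Lambda_gt0 : 0 < Lambda).
Hypotheses (Phi_cont : continuous Phi) (Phi0 : Phi 0 = 0).
Hypothesis Phi_growth : forall t, Lambda^-1 * `|t| `^ p <= Phi t * t
                                  /\ Phi t * t <= Lambda * `|t| `^ p.
Hypothesis K_meas : lebesgue_measurable2 (fun z => K z.1 z.2).
Hypothesis K_bounds : forall x y, x != y ->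
  1 / (Lambda * enorm (x - y) `^ (N%:R + s * p)) <= K x y /\
  K x y <= Lambda / enorm (x - y) `^ (N%:R + s * p).

Lemma normr_Phi_le t : `|Phi t| <= Lambda * `|t| `^ (p - 1).
Proof.
have [->|t0] := eqVneq t 0.
  by rewrite Phi0 normr0 mulr_ge0 ?powR_ge0// ltW.
have t_gt0 : 0 < `|t| by rewrite normr_gt0.
have [Pge Ple] := Phi_growth t.
have Pt0 : 0 <= Phi t * t.
  by apply: le_trans Pge; rewrite mulr_ge0 ?powR_ge0// invr_ge0 ltW.
rewrite -(ler_pM2r t_gt0) -normrM ger0_norm//.
apply: le_trans Ple _; rewrite -mulrA [_ `^ (p - 1) * _]mulrC mulr_powRB1//.
by rewrite (lt_trans _ p_gt1).
Qed.

(** This holds everywhere: on the diagonal, where [K] is unconstrained, the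
   increment of [f] vanishes. *)
Lemma form_integrand_le u f z :
  `|Phi (u z.1 - u z.2) * (f z.1 - f z.2) * K z.1 z.2| <=
  Lambda ^+ 2 * (gquot s p u z `^ (p - 1) * gquot s p f z).
Proof.
have p0 : p != 0 by rewrite gt_eqF// (lt_trans _ p_gt1).
case: z => x y /=.
have [->|xy] := eqVneq x y.
  rewrite subrr Phi0 !mul0r normr0.
  by rewrite mulr_ge0 ?sqr_ge0// mulr_ge0 ?powR_ge0// gquot_ge0.
have d_gt0 : 0 < enorm (x - y).
  by rewrite lt_neqAle enorm_ge0 eq_sym enorm_eq0 subr_eq0 xy.
have dn0 := lt0r_neq0 d_gt0.
have [K_ge K_le] := K_bounds xy.
have K0 : 0 <= K x y.
  by apply: le_trans K_ge; rewrite divr_ge0// mulr_ge0 ?powR_ge0// ltW.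
rewrite !normrM (ger0_norm K0).
have -> : Lambda ^+ 2 * (gquot s p u (x, y) `^ (p - 1) * gquot s p f (x, y)) =
    Lambda * `|u x - u y| `^ (p - 1) * `|f x - f y| *
    (Lambda / enorm (x - y) `^ (N%:R + s * p)).
  rewrite /gquot/= powRM ?powR_ge0// -powRrM.
  set e := N%:R + s * p; set d := enorm _.
  have -> : (d `^ e)^-1 = d `^ (- (e / p) * (p - 1)) * d `^ (- (e / p)).
    rewrite -powRD ?(negbTE dn0) ?implybT//.
    by rewrite mulrBr mulr1 subrK mulNr divfK// powRN.
  ring.
by apply: ler_pM => //; rewrite ler_wpM2r// normr_Phi_le.
Qed.

Lemma nonlocal_form_dual (Omega : set 'rV[R]_N) (u : 'rV[R]_N -> R) :
  Wsp s p u -> dual_W0sp s p Omega (nonlocal_form Phi K u).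
Proof.
move=> [u_Lp u_fin].
have mfunW (f : 'rV[R]_N -> R) : f \in Lfun (lebesgue_rV N) p%:E ->
    measurable_fun setT f by move=> /sub_Lfun_mfun; rewrite inE.
have mu := mfunW _ u_Lp.
have [g mg Kg] := K_meas.
(* [J f] is the integrand of the form and [I f] its Borel version. *)
pose J f (z : 'rV[R]_N * 'rV[R]_N) :=
  Phi (u z.1 - u z.2) * (f z.1 - f z.2) * K z.1 z.2.
pose I f (z : 'rV[R]_N * 'rV[R]_N) :=
  Phi (u z.1 - u z.2) * (f z.1 - f z.2) * g z.
have JI f : {ae lebesgue2, forall z, J f z = I f z}.
  by move: Kg; apply: filterS => z; rewrite /J /I => ->.
have mI f : measurable_fun setT f -> measurable_fun setT (I f).
  move=> mf; apply: measurable_funM mg; apply: measurable_funM.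
    apply: (measurableT_comp (continuous_measurable_fun Phi_cont)).
    exact: measurable_increment.
  exact: measurable_increment.
have IJle f : {ae lebesgue2, forall z,
    (`|I f z|%:E <= (Lambda ^+ 2 *
       (gquot s p u z `^ (p - 1) * gquot s p f z))%:E)%E}.
  by move: (JI f); apply: filterS => z <-; rewrite lee_fin form_integrand_le.
have [C C0 HC] : exists2 C : R, 0 <= C & forall f, measurable_fun setT f ->
    (\int[lebesgue2]_z `|I f z|%:E <= C%:E * gagliardo s p f)%E.
  have [C C0 HC] := hoelder_gquot p_gt1 mu u_fin.
  exists (Lambda ^+ 2 * C) => [|f mf]; first by rewrite mulr_ge0 ?sqr_ge0.
  have w0 z : 0 <= gquot s p u z `^ (p - 1) * gquot s p f z.
    by rewrite mulr_ge0 ?powR_ge0// gquot_ge0.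
  apply: (@le_trans _ _ (\int[lebesgue2]_z (Lambda ^+ 2 *
       (gquot s p u z `^ (p - 1) * gquot s p f z))%:E)%E).
    apply: ge0_le_integral_ae (IJle f) => z; rewrite lee_fin//.
    by rewrite mulr_ge0 ?sqr_ge0.
  under eq_integral do rewrite EFinM.
  have mw : measurable_fun setT
      (fun z => gquot s p u z `^ (p - 1) * gquot s p f z).
    apply: measurable_funM; last exact: measurable_gquot.
    exact: (measurableT_comp (measurable_powR _) (measurable_gquot _ _ mu)).
  rewrite ge0_integralZl_EFin ?sqr_ge0//.
  - rewrite (EFinM _ C) -muleA; apply: lee_wpmul2l; last exact: HC.
    by rewrite lee_fin sqr_ge0.
  - by move=> z _; rewrite lee_fin.
  - exact/measurable_EFinP.
have intI f : W0sp s p Omega f -> lebesgue2.-integrable setT (EFin \o I f).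
  move=> [[f_Lp f_fin] _]; have mf := mfunW _ f_Lp.
  apply/integrableP; split.
    by apply/measurable_EFinP; apply: mI; exact: mf.
  by apply: le_lt_trans (HC f mf) _; rewrite lte_mul_pinfty.
have formE f : nonlocal_form Phi K u f = \int[lebesgue2]_z I f z.
  exact: (Rintegral_ae_eq (JI f)).
split=> [a f v fW vW|].
  have intf := intI _ fW; have intv := intI _ vW.
  rewrite !formE -RintegralZl// -RintegralD//; last first.
    by have := integrableZl measurableT a intf.
  by apply: eq_Rintegral => z _; rewrite /I/=; ring.
exists C => f fW; have [[f_Lp _] _] := fW; have mf := mfunW _ f_Lp.
apply: le_trans (HC f mf); rewrite formE EFin_normr_Rintegral//.
  apply: le_abse_integral => //.
  by apply/measurable_EFinP; apply: mI; exact: mf.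
exact: intI.
Qed.

End nonlocal_form_dual.

(** * Cubes and bounded sets *)

Section cubes.
Context {R : realType} {N : nat}.
Implicit Types x y : 'rV[R]_N.

(** The closed cube of centre [x] and half-side [t]. *)
Definition cube x (t : R) : set 'rV[R]_N :=
  [set y | forall i, x ord0 i - t <= y ord0 i <= x ord0 i + t].

Lemma measurable_cube x t : measurable (cube x t).
Proof.
rewrite (_ : cube x t = \bigcap_(i in [set: 'I_N])
    ((fun y => y ord0 i) @^-1` `[x ord0 i - t, x ord0 i + t]%classic)).
  apply: fin_bigcap_measurable => // i _.
  rewrite -[X in measurable X]setTI.
  by apply: measurable_coord_rV => //; exact: measurable_itv.
apply/seteqP; split=> [y /= yP i _ /=|y /= yP i]; first by rewrite in_itv/=.
by have := yP i I; rewrite /= in_itv.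
Qed.

Lemma lebesgue_cube x t : 0 <= t ->
  lebesgue_rV N (cube x t) = ((2 * t) ^+ N)%:E.
Proof.
move=> t0; pose a := x - const_mx t; pose b := x + const_mx t.
rewrite (_ : cube x t = [set y | forall i, a ord0 i <= y ord0 i <= b ord0 i]).
  rewrite lebesgue_rV_box => [|i]; last by rewrite !mxE; lra.
  rewrite (eq_bigr (fun=> 2 * t)) => [|i _]; last by rewrite !mxE; ring.
  by rewrite prodr_const card_ord.
by apply/seteqP; split=> y /= yP i; have := yP i; rewrite !mxE.
Qed.

Lemma enorm_cube_le x y t : 0 <= t -> cube x t y -> enorm (x - y) <= N%:R * t.
Proof.
move=> t0 xty; rewrite -[leRHS]ger0_norm ?mulr_ge0// -sqrtr_sqr.
rewrite ler_sqrt ?sqr_ge0//.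
apply: (@le_trans _ _ (\sum_(i < N) t ^+ 2)).
  apply: ler_sum => i _; rewrite !mxE.
  rewrite -[leLHS]real_normK ?num_real// -[leRHS]real_normK ?num_real//.
  have /andP[? ?] := xty i.
  by rewrite lerXn2r ?nnegrE// (ger0_norm t0) ler_norml; apply/andP; split; lra.
rewrite sumr_const card_ord -[leLHS]mulr_natl exprMn ler_wpM2r ?sqr_ge0//.
by rewrite -natrX ler_nat; case: N => // n; rewrite leq_pmulr.
Qed.

Lemma bounded_lebesgue_lty (A : set 'rV[R]_N) : measurable A -> bounded_set A ->
  (lebesgue_rV N A < +oo)%E.
Proof.
move=> mA /pinfty_ex_gt0[M M0 AM].
apply: (@le_lt_trans _ _ (lebesgue_rV N (cube 0 M))).
  apply: le_measure; rewrite ?inE//; first exact: measurable_cube.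
  move=> y Ay i; rewrite mxE sub0r add0r -ler_norml.
  apply: le_trans (AM _ Ay).
  rewrite [leRHS]/Num.norm /= mx_normrE; apply/bigmax_geP; right.
  by exists (ord0, i).
by rewrite lebesgue_cube ?ltry// ltW.
Qed.

End cubes.

(** * Subcritical fractional Sobolev embedding *)

Section fractional_sobolev.
Context {R : realType} {N : nat}.
Variables (s p : R) (u : 'rV[R]_N -> R).
Hypotheses (N_gt0 : (0 < N)%N) (s_gt0 : 0 < s) (p_gt0 : 0 < p).
Hypothesis mu : measurable_fun setT u.

Let mpow r := @measurable_normr_powR _ _ R u r mu.

(** Markov's inequality for |u|^r. *)
Lemma levelset_le (r a : R) : 0 < a ->
  ((a `^ r)%:E * lebesgue_rV N [set y | (a `^ r <= `|u y| `^ r)%R] <=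
   \int[lebesgue_rV N]_x (`|u x| `^ r)%:E)%E.
Proof.
move=> a0.
have mur : measurable_fun setT (fun x => (`|u x| `^ r)%:E).
  by apply/measurable_EFinP; exact: mpow.
have := le_integral_abse (lebesgue_rV N) measurableT mur (powR_gt0 r a0).
rewrite setTI; under eq_integral do rewrite /= ger0_norm ?powR_ge0//.
congr (_ * lebesgue_rV N _ <= _)%E.
by apply/seteqP; split=> y /=; rewrite (ger0_norm (powR_ge0 _ _)) lee_fin.
Qed.

(** The nonlocal energy density of [u] at [x] controls a power of |u x|. *)
Lemma gquot_lower_bound (r M : R) : 0 < r -> 0 < M ->
  (\int[lebesgue_rV N]_x (`|u x| `^ r)%:E <= M%:E)%E ->
  exists2 c : R, 0 < c & forall x,
    ((c * `|u x| `^ (p + s * p / N%:R * r))%:E <=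
     \int[lebesgue_rV N]_y (gquot s p u (x, y) `^ p)%:E)%E.
Proof.
move=> r0 M0 uM.
have N0 : 0 < N%:R :> R by rewrite ltr0n.
have sp0 : 0 < s * p by rewrite mulr_gt0.
set e := N%:R + s * p; have e0 : 0 < e by rewrite addr_gt0.
pose k := 2 `^ (1 + r) * M; have k0 : 0 < k by rewrite mulr_gt0// powR_gt0.
pose kp := s * p / N%:R.
have kp0 : 0 < kp by rewrite divr_gt0.
(* For a = |u x| this constant is kappa * (V / 2) / a^(p + (sp/N) r), with V
   and kappa as below; the powers of a cancel. *)
exists (2 `^ (- p) * (N%:R / 2) `^ (- e) * (k `^ (- kp) / 2)) => [|x].
  by rewrite !mulr_gt0 ?powR_gt0 ?divr_gt0.
have D0 : (0 <= \int[lebesgue_rV N]_y (gquot s p u (x, y) `^ p)%:E)%E.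
  by apply: integral_ge0 => y _; rewrite lee_fin powR_ge0.
rewrite -/kp; have [ux0|ux0] := eqVneq (u x) 0.
  by rewrite ux0 normr0 powR0 ?mulr0// gt_eqF// addr_gt0// mulr_gt0.
set a := `|u x|; have a0 : 0 < a by rewrite normr_gt0.
(* The volume V of the cube is chosen so that, by Markov's inequality, the set
   B where |u| >= a / 2 has measure at most V / 2. *)
pose V := k * a `^ (- r); have V0 : 0 < V by rewrite mulr_gt0// powR_gt0.
pose t := V `^ N%:R^-1 / 2; have t0 : 0 < t by rewrite divr_gt0// powR_gt0.
have tV : (2 * t) ^+ N = V.
  rewrite /t mulrC divfK// -powR_mulrn ?powR_ge0// -powRrM mulVf ?lt0r_neq0//.
  by rewrite powRr1// ltW.
pose B := [set y | ((a / 2) `^ r <= `|u y| `^ r)%R].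
have mB : measurable B.
  rewrite (_ : B = setT `&` (fun y => `|u y| `^ r) @^-1` `[(a / 2) `^ r, +oo[).
    by apply: mpow => //; exact: measurable_itv.
  by rewrite setTI; apply/seteqP; split=> y; rewrite /B/= in_itv/= andbT.
have a20 : 0 < a / 2 by rewrite divr_gt0.
have ahalf b : (a / 2) `^ b = a `^ b * 2 `^ (- b).
  rewrite (powRM _ (ltW a0)) ?invr_ge0//; congr (_ * _).
  by rewrite -(powR_inv1 (ler0n _ 2)) -powRrM mulN1r.
have BV : (lebesgue_rV N B <= (V / 2)%:E)%E.
  have := le_trans (levelset_le r a20) uM.
  rewrite -/B -lee_pdivlMl ?powR_gt0// => /le_trans; apply.
  rewrite -EFinM lee_fin le_eqVlt; apply/orP; left; apply/eqP.
  rewrite ahalf /V /k !powRN powRD ?pnatr_eq0 ?implybT// powRr1//.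
  have : a `^ r != 0 by rewrite gt_eqF// powR_gt0.
  have : 2 `^ r != 0 :> R by rewrite gt_eqF// powR_gt0.
  by move=> ? ?; field; apply/andP.
have mQ := measurable_cube x t.
have QB : ((V / 2)%:E <= lebesgue_rV N (cube x t `\` B))%E.
  have VE : (lebesgue_rV N (cube x t) = lebesgue_rV N (cube x t `\` B) +
      lebesgue_rV N (cube x t `&` B))%E by exact: measureDI.
  rewrite lebesgue_cube ?ltW// tV in VE.
  have QBV : (lebesgue_rV N (cube x t `&` B) <= (V / 2)%:E)%E.
    apply: le_trans BV; apply: le_measure; rewrite ?inE//.
    exact: measurableI.
  rewrite leNgt; apply/negP => QDV.
  have : (V%:E < (V / 2)%:E + (V / 2)%:E)%E.
    rewrite VE; apply: lte_leD => //.
    by rewrite ge0_fin_numE// (le_lt_trans QBV)// ltry.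
  by rewrite -EFinD -splitr ltxx.
(* On the rest of the cube the integrand is at least kappa. *)
pose kappa := (a / 2) `^ p / (N%:R * t) `^ e.
have kappa0 : 0 <= kappa by rewrite divr_ge0 ?powR_ge0.
have mD : measurable_fun setT (fun y => (gquot s p u (x, y) `^ p)%:E).
  apply/measurable_EFinP; apply: (measurableT_comp (measurable_powR _)).
  exact: (measurableT_comp (measurable_gquot _ _ mu) (measurable_pair1 x)).
have mQB := measurableD mQ mB.
apply: (@le_trans _ _ (kappa * (V / 2))%:E); last first.
  apply: (@le_trans _ _ (\int[lebesgue_rV N]_(y in cube x t `\` B) kappa%:E)%E).
    by rewrite integral_cst// EFinM; apply: lee_wpmul2l; rewrite ?lee_fin.
  apply: (@le_trans _ _ (\int[lebesgue_rV N]_(y in cube x t `\` B)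
      (gquot s p u (x, y) `^ p)%:E)%E); last first.
    by apply: ge0_subset_integral => // y _; rewrite lee_fin powR_ge0.
  apply: ge0_le_integral => //; first exact: measurable_funTS.
  move=> y [Qy /negP]; rewrite -ltNge => uy.
  have {}uy : `|u y| < a / 2.
    rewrite ltNge; apply: contraTN uy => uy; rewrite -leNgt.
    by rewrite ge0_ler_powR ?nnegrE// ltW.
  have duv : a / 2 <= `|u x - u y|.
    by have := lerB_dist (u x) (u y); rewrite -/a; lra.
  have xy : x != y by apply: contraTneq duv => ->; rewrite subrr normr0 -ltNge.
  have d0 : 0 < enorm (x - y).
    by rewrite lt_neqAle enorm_ge0 eq_sym enorm_eq0 subr_eq0 xy.
  rewrite lee_fin gquot_powR ?lt0r_neq0//=; apply: ler_pM.
  - exact: powR_ge0.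
  - by rewrite invr_ge0 powR_ge0.
  - by rewrite ge0_ler_powR ?nnegrE// ltW.
  have Nt0 : 0 < N%:R * t := mulr_gt0 N0 t0.
  rewrite lef_pV2 ?posrE ?powR_gt0//.
  have t_ge0 := ltW t0; apply: ge0_ler_powR.
  - exact: ltW.
  - by rewrite nnegrE enorm_ge0.
  - by rewrite nnegrE; exact: (mulr_ge0 (ler0n _ N) t_ge0).
  - exact: enorm_cube_le.
rewrite lee_fin le_eqVlt; apply/orP; left; apply/eqP.
have an0 := lt0r_neq0 a0; have kn0 := lt0r_neq0 k0.
have Vn0 := lt0r_neq0 V0.
have eN : e / N%:R = 1 + kp by rewrite /e mulrDl divff ?lt0r_neq0.
have -> : kappa =
    2 `^ (- p) * a `^ p * ((N%:R / 2) `^ (- e) * V `^ (- (1 + kp))).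
  rewrite /kappa ahalf -powRN [a `^ p * _]mulrC; congr (_ * _).
  rewrite /t mulrA [_ * V `^ _]mulrC -mulrA [V `^ _ * _]mulrC -powR_inv1//.
  rewrite powRM ?powR_ge0 ?mulr_ge0 ?invr_ge0//; congr (_ * _).
  by rewrite -powRrM -eN mulrN [_^-1 * e]mulrC.
have -> : V `^ (- (1 + kp)) = V^-1 * (k `^ (- kp) * a `^ (kp * r)).
  rewrite opprD powRD ?Vn0 ?implybT// powR_inv1 ?ltW//; congr (_ * _).
  by rewrite /V powRM ?powR_ge0 ?ltW// -powRrM mulrNN [r * kp]mulrC.
rewrite powRD ?an0 ?implybT//.
by field.
Qed.

Hypothesis u_fin : (gagliardo s p u < +oo)%E.

(** One step of the bootstrap: the pointwise bound is integrated in [x] by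
   Tonelli's theorem. *)
Lemma integrability_gain (r : R) : 0 < r ->
  (\int[lebesgue_rV N]_x (`|u x| `^ r)%:E < +oo)%E ->
  (\int[lebesgue_rV N]_x (`|u x| `^ (p + s * p / N%:R * r))%:E < +oo)%E.
Proof.
move=> r0 ur.
have I0 : (0 <= \int[lebesgue_rV N]_x (`|u x| `^ r)%:E)%E.
  by apply: integral_ge0 => x _; rewrite lee_fin powR_ge0.
pose M := fine (\int[lebesgue_rV N]_x (`|u x| `^ r)%:E) + 1.
have M0 : 0 < M by rewrite ltr_wpDl// fine_ge0.
have uM : (\int[lebesgue_rV N]_x (`|u x| `^ r)%:E <= M%:E)%E.
  by rewrite EFinD fineK ?ge0_fin_numE// leeDl.
have [c c0 Hc] := gquot_lower_bound r0 M0 uM.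
pose G (z : 'rV[R]_N * 'rV[R]_N) := (gquot s p u z `^ p)%:E.
have mG : measurable_fun setT G.
  apply/measurable_EFinP; apply: (measurableT_comp (measurable_powR _)).
  exact: measurable_gquot.
have G0 z : (0 <= G z)%E by rewrite lee_fin powR_ge0.
have cI : (\int[lebesgue_rV N]_x
    (c * `|u x| `^ (p + s * p / N%:R * r))%:E < +oo)%E.
  apply: le_lt_trans (gquot_integral_lty (lt0r_neq0 p_gt0) u_fin).
  rewrite /lebesgue2 (fubini_tonelli1 _ mG G0).
  apply: ge0_le_integral => //.
  - by move=> x _; rewrite lee_fin mulr_ge0 ?powR_ge0// ltW.
  - by apply/measurable_EFinP; apply: measurable_funM => //; exact: mpow.
  - exact: measurable_fun_fubini_tonelli_F.
have : (\int[lebesgue_rV N]_x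
    (c^-1%:E * (c * `|u x| `^ (p + s * p / N%:R * r))%:E) < +oo)%E.
  rewrite ge0_integralZl_EFin ?invr_ge0 ?(ltW c0)//.
  - by rewrite lte_mul_pinfty// lee_fin invr_ge0 ltW.
  - by move=> x _; rewrite lee_fin mulr_ge0 ?powR_ge0// ltW.
  - by apply/measurable_EFinP; apply: measurable_funM => //; exact: mpow.
by under eq_integral do rewrite -EFinM mulKf ?lt0r_neq0//.
Qed.

(** The last hypothesis says that [q] lies below the fixed point p / (1 - sp/N)
   of r |-> p + (sp/N) r when sp < N, and holds for every [q] otherwise. *)
Lemma subcritical_integrability (q : R) :
  (\int[lebesgue_rV N]_x (`|u x| `^ p)%:E < +oo)%E ->
  0 < q -> (1 - s * p / N%:R) * q < p ->
  exists2 r, q <= r & (\int[lebesgue_rV N]_x (`|u x| `^ r)%:E < +oo)%E.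
Proof.
move=> up q0 qp; set alpha := s * p / N%:R in qp.
have alpha0 : 0 < alpha by rewrite !mulr_gt0// invr_gt0 ltr0n.
(* While r < q, each step increases the exponent by at least delta. *)
pose delta := Num.min p (p - (1 - alpha) * q).
have delta0 : 0 < delta by rewrite lt_min p_gt0 subr_gt0.
suff H n : exists r, [/\ 0 < r, q <= r \/ n%:R * delta <= r
    & (\int[lebesgue_rV N]_x (`|u x| `^ r)%:E < +oo)%E].
  have [r [_ [qr|nr] ur]] := H (Num.bound (q / delta)); exists r => //.
  apply: le_trans nr; rewrite -ler_pdivrMr// ltW//.
  by apply: archi_boundP; rewrite divr_ge0// ltW.
elim: n => [|n [r [r0 qr ur]]].
  by exists p; split => //; right; rewrite mul0r ltW.
have [qr'|rq] := leP q r; first by exists r; split => //; left.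
case: qr => [|nr]; first by rewrite leNgt rq.
exists (p + alpha * r); split; last exact: integrability_gain.
  by rewrite addr_gt0// mulr_gt0.
right; rewrite -addn1 natrD mulrDl mul1r.
suff : delta <= p - (1 - alpha) * r by lra.
have [al|al] := leP alpha 1.
  rewrite ge_min; apply/orP; right; rewrite lerD2l lerN2.
  by apply: ler_wpM2l; [rewrite subr_ge0 | exact: ltW].
rewrite ge_min; apply/orP; left; rewrite -[leLHS]subr0 lerD2l lerN2.
by rewrite nmulr_rle0 ?ltW// subr_lt0.
Qed.

End fractional_sobolev.

(** Subcritical fractional Sobolev embedding on sets of finite measure, for the
   exponent q - 1. *)
Lemma Wsp_powR_integrable (R : realType) (N : nat) (s p q : R)
    (Omega : set 'rV[R]_N) (u : 'rV[R]_N -> R) :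
  (0 < N)%N -> 0 < s -> 1 <= p -> 1 < q ->
  (q%:E < sobolev_exponent N s p)%E ->
  measurable Omega -> (lebesgue_rV N Omega < +oo)%E -> Wsp s p u ->
  (lebesgue_rV N).-integrable Omega (fun x => (`|u x| `^ (q - 1))%:E).
Proof.
move=> N0 s0 p1 q1 q_lt mO O_fin [u_Lp u_fin].
have p0 : 0 < p by rewrite (lt_le_trans ltr01).
have q0 : 0 < q by rewrite (lt_trans ltr01).
have mu : measurable_fun setT u by move: u_Lp => /sub_Lfun_mfun; rewrite inE.
have mpow r : measurable_fun setT (fun x => (`|u x| `^ r)%:E).
  by apply/measurable_EFinP; exact: measurable_normr_powR.
have up : (\int[lebesgue_rV N]_x (`|u x| `^ p)%:E < +oo)%E.
  have /integrableP[_] := Lfun_integrable p1 u_Lp.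
  by under eq_integral do rewrite /= ger0_norm ?powR_ge0//.
have NR0 : 0 < N%:R :> R by rewrite ltr0n.
have qp : (1 - s * p / N%:R) * q < p.
  move: q_lt; rewrite /sobolev_exponent; case: ifPn => [sN|]; last first.
    rewrite -leNgt => Ns _; apply: le_lt_trans p0.
    rewrite mulr_le0_ge0 ?(ltW q0)//.
    by rewrite subr_le0 ler_pdivlMr// mul1r.
  rewrite lte_fin ltr_pdivlMr ?subr_gt0// => H.
  rewrite -(ltr_pM2l NR0); apply: le_lt_trans H.
  by rewrite mulrA mulrBr mulr1 mulrCA divff ?lt0r_neq0// mulr1 mulrC.
have [r qr ur] := subcritical_integrability N0 s0 p0 mu u_fin up q0 qp.
have intr : (lebesgue_rV N).-integrable Omega (fun x => (`|u x| `^ r)%:E).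
  apply: (@integrableS _ _ _ _ setT) => //; apply/integrableP; split => //.
  by under eq_integral do rewrite /= ger0_norm ?powR_ge0//.
have int1 : (lebesgue_rV N).-integrable Omega (cst 1%:E).
  apply/integrableP; split; first exact: measurable_cst.
  by rewrite /= normr1 integral_cst// mul1e.
apply: le_integrable (integrableD mO int1 intr) => //.
  exact: measurable_funTS.
move=> x _ /=; rewrite lee_fin ger0_norm ?powR_ge0//.
rewrite (ger0_norm (addr_ge0 _ _)) ?powR_ge0//.
(* |u|^(q-1) <= 1 where |u| <= 1, and |u|^(q-1) <= |u|^r elsewhere. *)
have [u1|u1] := leP `|u x| 1.
  rewrite ler_wpDr ?powR_ge0//.
  rewrite -[leRHS](_ : 1 `^ (q - 1) = 1); last by rewrite powR1.
  by apply: ge0_ler_powR; rewrite ?nnegrE// subr_ge0 ltW.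
by rewrite ler_wpDl// ler_powR ?ltW//; lra.
Qed.

(** * Test functions and the decomposition of the measure *)

Lemma Cc_infty_bounded (R : realType) (N : nat) (Omega : set 'rV[R]_N) f :
  Cc_infty Omega f -> continuous f /\ exists M, forall x, `|f x| <= M.
Proof.
move=> [/(_ 0%N) /= cf cpt _]; split=> //.
have : compact (f @` closure [set x | f x != 0]).
  by apply: continuous_compact => //; exact: continuous_subspaceT.
move=> /compact_bounded /pinfty_ex_gt0[M M0 fM].
exists M => x; have [->|fx] := eqVneq (f x) 0; first by rewrite normr0 ltW.
by apply: fM; exists x => //; exact: subset_closure.
Qed.

Lemma continuous_measurable_rV (R : realType) (N : nat) (f : 'rV[R]_N -> R) :
  continuous f -> measurable_fun setT f.
Proof.
move=> /continuousP cf.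
apply: (measurability _ (measurable_realfun.RGenOpens.measurableE R)) => //.
move=> _ [_ [a [b ->] <-]]; rewrite setTI; apply: open_measurable_rV.
by apply: cf; exact: interval_open.
Qed.

Theorem theorem4p1 (R : realType) (N : nat) (N_ge2 : (2 <= N)%N)
    (Omega : set 'rV[R]_N) (Omega_open : open Omega)
    (Omega_bounded : bounded_set Omega)
    (s p q lambda Lambda : R)
    (s_gt0 : 0 < s) (s_lt1 : s < 1)
    (p_gt2 : 2 < p) (p_lt_q : p < q)
    (q_lt : (q%:E < sobolev_exponent N s p)%E)
    (lambda_gt0 : 0 < lambda) (Lambda_ge1 : 1 <= Lambda)
    (Phi : R -> R) (Phi_cont : continuous Phi) (Phi0 : Phi 0 = 0)
    (Phi_growth : forall t, Lambda^-1 * `|t| `^ p <= Phi t * t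
                            /\ Phi t * t <= Lambda * `|t| `^ p)
    (K : 'rV[R]_N -> 'rV[R]_N -> R)
    (K_meas : lebesgue_measurable2 (fun z => K z.1 z.2))
    (K_bounds : forall x y, x != y ->
       1 / (Lambda * enorm (x - y) `^ (N%:R + s * p)) <= K x y /\
       K x y <= Lambda / enorm (x - y) `^ (N%:R + s * p))
    (mu : signed_radon Omega) (u : 'rV[R]_N -> R)
    (u_sol : weak_solution s p q lambda Phi K mu u) :
  L1_plus_dual s p mu.
Proof.
have p_gt1 : 1 < p by lra.
have Lambda_gt0 : 0 < Lambda by lra.
have N_gt0 : (0 < N)%N by exact: ltn_trans N_ge2.
have [[uW _] u_eq] := u_sol.
have mu' : measurable_fun setT u.
  by move: uW.1 => /sub_Lfun_mfun; rewrite inE.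
have mO : measurable Omega by exact: open_measurable_rV.
pose g x := `|u x| `^ (q - 2) * u x.
have gE x : `|g x| = `|u x| `^ (q - 1).
  rewrite /g (_ : q - 2 = q - 1 - 1); last by ring.
  by rewrite normrM ger0_norm ?powR_ge0// mulrC mulr_powRB1//; lra.
have mg : measurable_fun setT g.
  by apply: measurable_funM => //; exact: measurable_normr_powR.
have intg : (lebesgue_rV N).-integrable Omega (EFin \o g).
  have := Wsp_powR_integrable N_gt0 s_gt0 (ltW p_gt1) _ q_lt mO
    (bounded_lebesgue_lty mO Omega_bounded) uW.
  move=> /(_ ltac:(lra)); apply: le_integrable => //.
    by apply/measurable_EFinP; apply: measurable_funTS; exact: mg.
  by move=> x _ /=; rewrite lee_fin gE [leRHS]ger0_norm ?powR_ge0.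
exists (fun x => - lambda * g x), (nonlocal_form Phi K u); split.
- have := integrableZl mO (- lambda) intg.
  by apply: eq_integrable.
- exact: (nonlocal_form_dual p_gt1 Lambda_gt0 Phi_cont Phi0 Phi_growth K_meas
    K_bounds Omega uW).
move=> f fC; have [cf [M fM]] := Cc_infty_bounded fC.
have mf := continuous_measurable_rV cf.
have intgf : (lebesgue_rV N).-integrable Omega (EFin \o (fun x => g x * f x)).
  apply: le_integrable (integrableZl mO M intg) => //.
    by apply/measurable_EFinP; apply: measurable_funTS; exact: measurable_funM.
  move=> x _ /=; rewrite lee_fin !normrM mulrC ler_wpM2r//.
  by rewrite (le_trans (fM x))// ler_norm.
under eq_Rintegral do rewrite -mulrA.
by rewrite RintegralZl// (u_eq f fC) mulNr addKr.
Qed.
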